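(* Let $\mathcal{C}$ be a category, $\mathcal{W}$ a class of morphisms of $\mathcal{C}$, and $H\colon\mathcal{C}\to\operatorname{Ho}\mathcal{C}$ a strict localisation of $\mathcal{C}$ at $\mathcal{W}$. Then for every category $\mathcal{D}$ the precomposition functor $H^*\colon\mathcal{D}^{\operatorname{Ho}\mathcal{C}}\to\mathcal{D}^{\mathcal{C}}$ is fully faithful; that is, for any functors $F,G\colon\operatorname{Ho}\mathcal{C}\to\mathcal{D}$ and any natural transformation $\tau\colon F\circ H\Rightarrow G\circ H$ there is a unique natural transformation $\bar\tau\colon F\Rightarrow G$ with $\bar\tau_H=\tau$.
   Context: A strict localisation of $\mathcal{C}$ at $\mathcal{W}$ is a functor $H\colon\mathcal{C}\to\operatorname{Ho}\mathcal{C}=\mathcal{C}[\mathcal{W}^{-1}]$ that sends all arrows in $\mathcal{W}$ to isomorphisms and such that every functor $F\colon\mathcal{C}\to\mathcal{D}$ sending all arrows in $\mathcal{W}$ to isomorphisms factors uniquely as $F=\bar F\circ H$ (equality of functors). Only this 1-categorical universal property is assumed. $\bar\tau_H$ denotes the whiskering with components $\bar\tau_{HC}$. *)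

(* Defs.v *)
From Stdlib Require Import FunctionalExtensionality ProofIrrelevance.

Set Implicit Arguments.
Unset Strict Implicit.
Unset Printing Implicit Defensive.

(* Objects and morphisms live in one common (floating) universe, so that functor
   categories are again of type [category]; "every category" below means every
   inhabitant of this type.  Equality of morphisms, natural transformations and
   functors is Leibniz equality. *)
Record category : Type := Category {
  obj :> Type;
  hom : obj -> obj -> Type;
  idc : forall x : obj, hom x x;
  comp : forall x y z : obj, hom y z -> hom x y -> hom x z;
  comp_idl : forall (x y : obj) (f : hom x y), comp (idc y) f = f;
  comp_idr : forall (x y : obj) (f : hom x y), comp f (idc x) = f;
  comp_assoc : forall (w x y z : obj) (h : hom y z) (g : hom x y) (f : hom w x),
    comp h (comp g f) = comp (comp h g) f
}.

Arguments idc {c} x.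
Arguments comp {c x y z} g f : rename.

Declare Scope cat_scope.
Delimit Scope cat_scope with cat.
Local Open Scope cat_scope.
Notation "g \o f" := (comp g f) (at level 50, left associativity) : cat_scope.

Definition is_iso (C : category) (x y : C) (f : hom x y) : Prop :=
  exists g : hom y x, g \o f = idc x /\ f \o g = idc y.

Record functor (C D : category) : Type := Functor {
  fobj :> C -> D;
  fmap : forall x y : C, hom x y -> hom (fobj x) (fobj y);
  fmap_id : forall x : C, fmap (idc x) = idc (fobj x);
  fmap_comp : forall (x y z : C) (g : hom y z) (f : hom x y),
    fmap (g \o f) = fmap g \o fmap f
}.

Arguments fmap {C D} F {x y} f : rename.

Lemma functor_comp_id (A B C : category) (G : functor B C) (F : functor A B)
  (x : A) : fmap G (fmap F (idc x)) = idc (G (F x)).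
Proof. now rewrite !fmap_id. Qed.

Lemma functor_comp_comp (A B C : category) (G : functor B C) (F : functor A B)
  (x y z : A) (g : hom y z) (f : hom x y) :
  fmap G (fmap F (g \o f)) = fmap G (fmap F g) \o fmap G (fmap F f).
Proof. now rewrite !fmap_comp. Qed.

Definition functor_comp (A B C : category) (G : functor B C) (F : functor A B) :
    functor A C :=
  @Functor A C (fun x => G (F x)) (fun x y f => fmap G (fmap F f))
    (functor_comp_id G F) (functor_comp_comp G F).

Notation "G \oF F" := (functor_comp G F) (at level 50, left associativity)
  : cat_scope.

Record nattrans (C D : category) (F G : functor C D) : Type := Nattrans {
  component :> forall x : C, hom (F x) (G x);
  naturality : forall (x y : C) (f : hom x y),
    component y \o fmap F f = fmap G f \o component x
}.

Lemma nattrans_ext (C D : category) (F G : functor C D) (s t : nattrans F G) :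
  (forall x : C, s x = t x) -> s = t.
Proof.
destruct s as [s sn], t as [t tn]; cbn; intros e.
apply functional_extensionality_dep in e; subst t.
now rewrite (proof_irrelevance _ sn tn).
Qed.

Lemma nattrans_id_natural (C D : category) (F : functor C D)
  (x y : C) (f : hom x y) : idc (F y) \o fmap F f = fmap F f \o idc (F x).
Proof. now rewrite comp_idl, comp_idr. Qed.

Definition nattrans_id (C D : category) (F : functor C D) : nattrans F F :=
  @Nattrans C D F F (fun x => idc (F x)) (@nattrans_id_natural C D F).

Lemma nattrans_comp_natural (C D : category) (F G K : functor C D)
  (t : nattrans G K) (s : nattrans F G) (x y : C) (f : hom x y) :
  t y \o s y \o fmap F f = fmap K f \o (t x \o s x).
Proof. now rewrite <- comp_assoc, naturality, comp_assoc, naturality, comp_assoc. Qed.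

Definition nattrans_comp (C D : category) (F G K : functor C D)
    (t : nattrans G K) (s : nattrans F G) : nattrans F K :=
  @Nattrans C D F K (fun x => t x \o s x) (nattrans_comp_natural t s).

Lemma nattrans_comp_idl (C D : category) (F G : functor C D) (t : nattrans F G) :
  nattrans_comp (nattrans_id G) t = t.
Proof. apply nattrans_ext; intros x; apply comp_idl. Qed.

Lemma nattrans_comp_idr (C D : category) (F G : functor C D) (t : nattrans F G) :
  nattrans_comp t (nattrans_id F) = t.
Proof. apply nattrans_ext; intros x; apply comp_idr. Qed.

Lemma nattrans_comp_assoc (C D : category) (F G K L : functor C D)
  (u : nattrans K L) (t : nattrans G K) (s : nattrans F G) :
  nattrans_comp u (nattrans_comp t s) = nattrans_comp (nattrans_comp u t) s.
Proof. apply nattrans_ext; intros x; apply comp_assoc. Qed.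

(* [functor_category C D] is the category written D^C. *)
Definition functor_category (C D : category) : category :=
  @Category (functor C D) (@nattrans C D) (@nattrans_id C D) (@nattrans_comp C D)
    (@nattrans_comp_idl C D) (@nattrans_comp_idr C D) (@nattrans_comp_assoc C D).

Lemma whisker_natural (B C D : category) (H : functor B C) (F G : functor C D)
  (t : nattrans F G) (x y : B) (f : hom x y) :
  t (H y) \o fmap (F \oF H) f = fmap (G \oF H) f \o t (H x).
Proof. exact (naturality t (fmap H f)). Qed.

Definition whisker (B C D : category) (F G : functor C D) (t : nattrans F G)
    (H : functor B C) : nattrans (F \oF H) (G \oF H) :=
  @Nattrans B D (F \oF H) (G \oF H) (fun x => t (H x)) (whisker_natural H t).

Lemma whisker_id (B C D : category) (H : functor B C) (F : functor C D) :
  whisker (nattrans_id F) H = nattrans_id (F \oF H).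
Proof. now apply nattrans_ext. Qed.

Lemma whisker_comp (B C D : category) (H : functor B C) (F G K : functor C D)
  (t : nattrans G K) (s : nattrans F G) :
  whisker (nattrans_comp t s) H = nattrans_comp (whisker t H) (whisker s H).
Proof. now apply nattrans_ext. Qed.

Definition precomposition (B C : category) (H : functor B C) (D : category) :
    functor (functor_category C D) (functor_category B D) :=
  @Functor (functor_category C D) (functor_category B D)
    (fun F => F \oF H) (fun F G t => whisker t H)
    (@whisker_id B C D H) (@whisker_comp B C D H).

Definition full (C D : category) (F : functor C D) : Prop :=
  forall (x y : C) (g : hom (F x) (F y)), exists f : hom x y, fmap F f = g.

Definition faithful (C D : category) (F : functor C D) : Prop :=
  forall (x y : C) (f g : hom x y), fmap F f = fmap F g -> f = g.

Definition fully_faithful (C D : category) (F : functor C D) : Prop :=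
  full F /\ faithful F.

Definition morphism_class (C : category) : Type :=
  forall x y : C, hom x y -> Prop.

Definition inverts (C D : category) (W : morphism_class C) (F : functor C D) :
    Prop :=
  forall (x y : C) (w : hom x y), W x y w -> is_iso (fmap F w).

Definition is_strict_localisation (C HoC : category) (W : morphism_class C)
    (H : functor C HoC) : Prop :=
  inverts W H /\
  forall (D : category) (F : functor C D), inverts W F ->
    exists! Fbar : functor HoC D, F = Fbar \oF H.

(* Main.v *)
(* A natural transformation F => G is the same as a functor into the arrow
   category of D with domain F and codomain G.  An arrow of Arr D whose domain and
   codomain parts are isomorphisms is itself one, so the functor C -> Arr D given by
   tau inverts W and factors through H as K : Ho C -> Arr D.  The uniqueness clause
   of the localisation forces dom K = F and cod K = G; applied to functors into
   Arr D, it also gives uniqueness of the extension. *)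
From Stdlib Require Import FunctionalExtensionality ProofIrrelevance.
Require Import Defs.
Local Open Scope cat_scope.

(** Sharing the object map [o] lets the morphism parts be compared without transport along
    equalities of objects. *)
Lemma functor_ext_same_obj (C D : category) (o : C -> D)
  (m m' : forall x y : C, hom x y -> hom (o x) (o y))
  (i : forall x : C, m x x (idc x) = idc (o x))
  (i' : forall x : C, m' x x (idc x) = idc (o x))
  (c : forall (x y z : C) (g : hom y z) (f : hom x y),
    m x z (g \o f) = m y z g \o m x y f)
  (c' : forall (x y z : C) (g : hom y z) (f : hom x y),
    m' x z (g \o f) = m' y z g \o m' x y f) :
  (forall (x y : C) (f : hom x y), m x y f = m' x y f) ->
  @Functor C D o m i c = @Functor C D o m' i' c'.
Proof.
intros e; assert (em : m = m').
{ extensionality x; extensionality y; extensionality f; apply e. }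
subst m'.
now rewrite (proof_irrelevance _ i i'), (proof_irrelevance _ c c').
Qed.

Lemma functor_comp_assoc (A B C D : category) (K : functor C D)
  (G : functor B C) (F : functor A B) : K \oF (G \oF F) = (K \oF G) \oF F.
Proof. now apply functor_ext_same_obj. Qed.

Lemma fmap_is_iso (C D : category) (F : functor C D) (x y : C) (f : hom x y) :
  is_iso f -> is_iso (fmap F f).
Proof.
intros [g [gf fg]]; exists (fmap F g).
now rewrite <- !fmap_comp, gf, fg, !fmap_id.
Qed.

Lemma inverts_comp (C B D : category) (W : morphism_class C)
  (F : functor B D) (H : functor C B) : inverts W H -> inverts W (F \oF H).
Proof. intros HW x y w Ww; exact (fmap_is_iso _ _ F _ _ _ (HW x y w Ww)). Qed.

(** Functors preserve isomorphisms, so [F \oF H] inverts [W]; both [F] and [G] are then its unique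
    factorisation through [H]. *)
Lemma localisation_functor_inj (C HoC D : category) (W : morphism_class C)
  (H : functor C HoC) (hH : is_strict_localisation W H)
  (F G : functor HoC D) : F \oF H = G \oF H -> F = G.
Proof.
intros e; destruct hH as [HW loc].
destruct (loc D (F \oF H) (inverts_comp _ _ _ W F H HW)) as [K [_ uniq]].
now rewrite <- (uniq F eq_refl), <- (uniq G e).
Qed.

Record arrow (D : category) : Type := Arrow {
  adom : D;
  acod : D;
  amap : hom adom acod
}.

Arguments Arrow {D adom acod} amap.
Arguments adom {D} a.
Arguments acod {D} a.
Arguments amap {D} a.

Lemma Arrow_inj (D : category) (x y : D) (f g : hom x y) :
  Arrow f = Arrow g -> f = g.
Proof.
intros e; injection e; intros e'.
(* The maps arrive packed in nested dependent pairs over both endpoints; each [inj_pair2] strips one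
   endpoint. *)
now apply inj_pair2 in e'; apply inj_pair2 in e'.
Qed.

Record square (D : category) (a b : arrow D) : Type := Square {
  sdom : hom (adom a) (adom b);
  scod : hom (acod a) (acod b);
  square_comm : amap b \o sdom = scod \o amap a
}.

Arguments Square {D a b} sdom scod square_comm.
Arguments sdom {D a b} s.
Arguments scod {D a b} s.

Lemma square_ext (D : category) (a b : arrow D) (s t : square D a b) :
  sdom s = sdom t -> scod s = scod t -> s = t.
Proof.
destruct s as [u v c], t as [u' v' c']; cbn; intros -> ->.
now rewrite (proof_irrelevance _ c c').
Qed.

Lemma square_id_comm (D : category) (a : arrow D) :
  amap a \o idc (adom a) = idc (acod a) \o amap a.
Proof. now rewrite comp_idl, comp_idr. Qed.

Lemma square_comp_comm (D : category) (a b c : arrow D)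
  (t : square D b c) (s : square D a b) :
  amap c \o (sdom t \o sdom s) = scod t \o scod s \o amap a.
Proof.
now rewrite comp_assoc, square_comm, <- comp_assoc, square_comm, comp_assoc.
Qed.

Definition arrow_category (D : category) : category.
Proof.
refine (@Category (arrow D) (square D)
  (fun a => Square (idc _) (idc _) (square_id_comm D a))
  (fun a b c t s => Square _ _ (square_comp_comm D a b c t s)) _ _ _);
  intros; apply square_ext; cbn;
  auto using comp_idl, comp_idr, comp_assoc.
Defined.

Definition dom_functor (D : category) : functor (arrow_category D) D :=
  @Functor (arrow_category D) D adom (fun a b s => sdom s)
    (fun a => eq_refl) (fun a b c t s => eq_refl).

Definition cod_functor (D : category) : functor (arrow_category D) D :=
  @Functor (arrow_category D) D acod (fun a b s => scod s)
    (fun a => eq_refl) (fun a b c t s => eq_refl).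

(** The universal natural transformation between functors into [D]: any other is its whiskering
    along a functor into the arrow category. *)
Definition dom_to_cod (D : category) : nattrans (dom_functor D) (cod_functor D) :=
  @Nattrans (arrow_category D) D (dom_functor D) (cod_functor D) amap
    (fun a b s => square_comm _ _ _ s).

Lemma arrow_is_iso (D : category) (a b : arrow_category D) (s : hom a b) :
  is_iso (sdom s) -> is_iso (scod s) -> is_iso s.
Proof.
intros [u [us su]] [v [vs sv]].
assert (c : amap a \o u = v \o amap b).
(* Insert [v \o scod s] on the left, slide across the square [s], then cancel [sdom s \o u]. *)
{ rewrite <- (comp_idl (amap a \o u)), <- vs.
  rewrite <- comp_assoc, (comp_assoc (scod s)), <- square_comm.
  now rewrite <- (comp_assoc (amap b)), su, comp_idr. }
exists (Square u v c); split; apply square_ext; assumption.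
Qed.

Definition arrow_functor (C D : category) (F G : functor C D)
  (t : nattrans F G) : functor C (arrow_category D).
Proof.
refine (@Functor C (arrow_category D) (fun x => Arrow (t x))
  (fun x y f => @Square D (Arrow (t x)) (Arrow (t y)) (fmap F f) (fmap G f)
                  (naturality t f)) _ _);
  intros; apply square_ext; cbn; auto using fmap_id, fmap_comp.
Defined.

Arguments arrow_functor {C D F G} t.

Lemma dom_arrow_functor (C D : category) (F G : functor C D)
  (t : nattrans F G) : dom_functor D \oF arrow_functor t = F.
Proof. destruct F; now apply functor_ext_same_obj. Qed.

Lemma cod_arrow_functor (C D : category) (F G : functor C D)
  (t : nattrans F G) : cod_functor D \oF arrow_functor t = G.
Proof. destruct G; now apply functor_ext_same_obj. Qed.

Lemma arrow_functor_whisker (B C D : category) (H : functor B C)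
  (F G : functor C D) (t : nattrans F G) :
  arrow_functor (whisker t H) = arrow_functor t \oF H.
Proof.
apply functor_ext_same_obj; intros x y f; now apply square_ext.
Qed.

Lemma arrow_functor_inj (C D : category) (F G : functor C D)
  (s t : nattrans F G) : arrow_functor s = arrow_functor t -> s = t.
Proof.
intros e; apply nattrans_ext; intros x; apply Arrow_inj.
exact (f_equal (fun K : functor C (arrow_category D) => K x) e).
Qed.

(** With [F] and [G] as variables, the two equations can be eliminated by substitution, leaving
    [dom_to_cod] whiskered along [K]. Comparing bundled arrows keeps the conclusion well typed
    although [K x] has endpoints only propositionally equal to [F x] and [G x]. *)
Lemma arrow_functor_surj (C D : category) (K : functor C (arrow_category D))
  (F G : functor C D) :
  dom_functor D \oF K = F -> cod_functor D \oF K = G ->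
  exists t : nattrans F G, forall x : C, Arrow (t x) = K x.
Proof.
intros <- <-; exists (whisker (dom_to_cod D) K).
intros x; cbn; now destruct (K x).
Qed.

Lemma localisation_whisker_inj (C HoC D : category) (W : morphism_class C)
  (H : functor C HoC) (hH : is_strict_localisation W H)
  (F G : functor HoC D) (s t : nattrans F G) :
  whisker s H = whisker t H -> s = t.
Proof.
intros e; apply arrow_functor_inj, (localisation_functor_inj _ _ _ _ _ hH).
now rewrite <- !arrow_functor_whisker, e.
Qed.

Lemma localisation_whisker_surj (C HoC D : category) (W : morphism_class C)
  (H : functor C HoC) (hH : is_strict_localisation W H)
  (F G : functor HoC D) (tau : nattrans (F \oF H) (G \oF H)) :
  exists taubar : nattrans F G, whisker taubar H = tau.
Proof.
assert (tauW : inverts W (arrow_functor tau)).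
(* The two sides of the image of [w] are its images under [F \oF H] and [G \oF H]. *)
{ intros x y w Ww; apply arrow_is_iso;
    apply (inverts_comp _ _ _ W _ H (proj1 hH) x y w Ww). }
destruct (proj2 hH _ _ tauW) as [K [eK _]].
destruct (arrow_functor_surj _ _ K F G) as [t et].
(* It suffices to compare after precomposing with [H], where [K \oF H] is [arrow_functor tau]. *)
- apply (localisation_functor_inj _ _ _ _ _ hH).
  now rewrite <- functor_comp_assoc, <- eK, dom_arrow_functor.
- apply (localisation_functor_inj _ _ _ _ _ hH).
  now rewrite <- functor_comp_assoc, <- eK, cod_arrow_functor.
- exists t; apply nattrans_ext; intros x; apply Arrow_inj; cbn.
  rewrite et.
  exact (eq_sym (f_equal (fun L : functor C (arrow_category D) => L x) eK)).
Qed.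

Theorem proposition1p7 (C : category) (W : morphism_class C) (HoC : category)
    (H : functor C HoC) (hH : is_strict_localisation W H) (D : category) :
  fully_faithful (precomposition H D) /\
  (forall (F G : functor HoC D) (tau : nattrans (F \oF H) (G \oF H)),
     exists! taubar : nattrans F G, whisker taubar H = tau).
Proof.
split; [split|].
- intros F G tau; exact (localisation_whisker_surj _ _ _ _ _ hH F G tau).
- intros F G s t; exact (localisation_whisker_inj _ _ _ _ _ hH F G s t).
- intros F G tau.
  destruct (localisation_whisker_surj _ _ _ _ _ hH F G tau) as [t et].
  exists t; split; [exact et|intros s es].
  apply (localisation_whisker_inj _ _ _ _ _ hH); now rewrite et, es.
Qed.
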